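(* Let $p\ge 2$ be a prime and let $a,b\in\mathbb{Q}_p$ with $a\neq 0$. For $c,e\in\mathbb{Q}_p$ with $c\ne 0$ write $f_{c,e}:\mathbb{Q}_p\to\mathbb{Q}_p$, $f_{c,e}(z)=cz+e$. Then $f_{a,b}$ is shadowing. Moreover, if $\|a\|_p\neq 1$, then $f_{a,b}$ is Lipschitz structurally stable; furthermore, the conjugation is an isometry (that is, there is $\varepsilon>0$ such that for every $\psi:\mathbb{Q}_p\to\mathbb{Q}_p$ that is Lipschitz with constant at most $\varepsilon$ and satisfies $\sup_x\|\psi(x)\|_p<\varepsilon$, there is an isometric homeomorphism $h:\mathbb{Q}_p\to\mathbb{Q}_p$ with $f_{a,b}\circ h=h\circ(f_{a,b}+\psi)$), and $f_{a,b}$ is topologically conjugate to $f_{1/p^k,0}$, where $k\in\mathbb{Z}\setminus\{0\}$ is given by $\|a\|_p=p^k$.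
   Context: $\mathbb{Q}_p$ is the field of $p$-adic numbers with the $p$-adic absolute value $\|\cdot\|_p$ (normalized so that $\|p\|_p=p^{-1}$) and metric $d(x,y)=\|x-y\|_p$. For a homeomorphism $f$ of a metric space $(X,d)$, $f$ is shadowing if for every $\varepsilon>0$ there is $\delta>0$ such that for every sequence $(x_n)_{n\in\mathbb{Z}}$ in $X$ with $d(f(x_n),x_{n+1})\le\delta$ for all $n\in\mathbb{Z}$ there is $x\in X$ with $d(x_n,f^n(x))\le\varepsilon$ for all $n\in\mathbb{Z}$. Two maps $f,g:X\to X$ of a metric space are topologically conjugate if there is a homeomorphism $h:X\to X$ with $f\circ h=h\circ g$. A continuous map $f:\mathbb{Q}_p\to\mathbb{Q}_p$ is Lipschitz structurally stable if there exists $\varepsilon>0$ such that for every map $\psi:\mathbb{Q}_p\to\mathbb{Q}_p$ that is Lipschitz with constant at most $\varepsilon$ and satisfies $\sup_x\|\psi(x)\|_p<\varepsilon$, the map $g=f+\psi$ is topologically conjugate to $f$. *)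

(* Defs.v *)
From HB Require Import structures.
From mathcomp Require Import all_boot all_order all_algebra.
From mathcomp Require Import generic_quotient ring_quotient.
From mathcomp Require Import all_classical all_reals all_analysis.

Set Implicit Arguments.
Unset Strict Implicit.
Unset Printing Implicit Defensive.

Import Order.TTheory GRing.Theory Num.Theory.
Import numFieldTopology.Exports.

Local Open Scope classical_set_scope.
Local Open Scope ring_scope.
Local Open Scope quotient_scope.

Section AbsoluteValue.
Context (R : realType) (p : nat).

Definition padic_val (q : rat) : int :=
  (logn p `|numq q|)%:Z - (logn p `|denq q|)%:Z.

Definition padic_abs (q : rat) : R :=
  if q == 0 then 0 else p%:R ^ (- padic_val q).

Hypothesis p_pr : prime p.

Let p_gt0 : 0 < p%:R :> R. Proof. by rewrite ltr0n prime_gt0. Qed.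

Lemma padic_abs0 : padic_abs 0 = 0. Proof. by rewrite /padic_abs eqxx. Qed.

Lemma padic_abs_gt0 q : q != 0 -> 0 < padic_abs q.
Proof. by rewrite /padic_abs => /negPf ->; rewrite exprz_gt0. Qed.

Lemma padic_abs_ge0 q : 0 <= padic_abs q.
Proof. by have [->|/padic_abs_gt0/ltW//] := eqVneq q 0; rewrite padic_abs0. Qed.

Lemma padic_abs_eq0 q : (padic_abs q == 0) = (q == 0).
Proof.
have [->|q0] := eqVneq q 0; first by rewrite padic_abs0 eqxx.
by rewrite gt_eqF // padic_abs_gt0.
Qed.

Lemma padic_absN q : padic_abs (- q) = padic_abs q.
Proof. by rewrite /padic_abs oppr_eq0 /padic_val numqN denqN abszN. Qed.

Lemma padic_val_frac (m n : int) : m != 0 -> n != 0 ->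
  padic_val (m%:Q / n%:Q) = (logn p `|m|)%:Z - (logn p `|n|)%:Z.
Proof.
move=> m0 n0; rewrite /padic_val; set q := m%:Q / n%:Q.
have nq0 : n%:Q != 0 by rewrite intr_eq0.
have q0 : q != 0 by rewrite mulf_neq0 ?invr_eq0 ?intr_eq0.
have E : numq q * n = m * denq q.
  apply: (@intr_inj rat); rewrite !intrM; apply: (mulIf (x := (denq q)%:~R^-1)).
    by rewrite invr_eq0 intr_eq0 denq_neq0.
  by rewrite mulfK ?intr_eq0 ?denq_neq0 // mulrAC divq_num_den mulfVK.
have /(congr1 (fun z : int => logn p `|z|%N)) := E.
rewrite !abszM !lognM ?absz_gt0 ?numq_eq0 ?denq_neq0 // => /(congr1 Posz).
by rewrite !PoszD => /(canRL (addrK _)) ->; rewrite addrAC addrK.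
Qed.

Lemma padic_absM q r : padic_abs (q * r) = padic_abs q * padic_abs r.
Proof.
have [->|q0] := eqVneq q 0; first by rewrite mul0r padic_abs0 mul0r.
have [->|r0] := eqVneq r 0; first by rewrite mulr0 padic_abs0 mulr0.
rewrite /padic_abs mulf_eq0 (negPf q0) (negPf r0) /=.
rewrite -expfzDr ?gt_eqF // -opprD; congr (_ ^ - _).
have -> : q * r = (numq q * numq r)%:Q / (denq q * denq r)%:Q.
  by rewrite !intrM invfM mulrACA !divq_num_den.
rewrite padic_val_frac ?mulf_neq0 ?numq_eq0 ?denq_neq0 //.
rewrite !abszM !lognM ?absz_gt0 ?numq_eq0 ?denq_neq0 //.
by rewrite !PoszD /padic_val opprD addrACA.
Qed.

Lemma padic_abs1 : padic_abs 1 = 1.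
Proof. by rewrite /padic_abs oner_eq0 /padic_val logn1 subrr oppr0. Qed.

Lemma padic_absV q : padic_abs q^-1 = (padic_abs q)^-1.
Proof.
have [->|q0] := eqVneq q 0; first by rewrite invr0 padic_abs0 invr0.
have a0 : padic_abs q != 0 by rewrite padic_abs_eq0.
by apply: (mulfI a0); rewrite -padic_absM !divff ?padic_abs1.
Qed.

Lemma padic_abs_int (m : int) : padic_abs m%:~R <= 1.
Proof.
have [->|m0] := eqVneq m 0; first by rewrite padic_abs0.
rewrite /padic_abs intr_eq0 (negPf m0) -[m%:~R]divr1.
rewrite (@padic_val_frac m 1) // logn1 subr0.
by rewrite -exprnN invf_le1 ?exprn_gt0 // exprn_ege1 // ler1n prime_gt0.
Qed.

Lemma padic_abs_le1P q : padic_abs q <= 1 -> ~~ (p %| `|denq q|)%N.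
Proof.
have [->|q0] := eqVneq q 0; first by rewrite dvdn1 neq_ltn prime_gt1 ?orbT.
apply: contraTN => pd; rewrite -ltNge /padic_abs (negPf q0).
have pn : ~~ (p %| `|numq q|)%N.
  apply: contraTN (coprime_num_den q) => pn.
  by apply/negP => /(coprime_dvdl pn)/(coprime_dvdr pd); rewrite /coprime gcdnn;
    rewrite eqn_leq leqNgt prime_gt1.
rewrite /padic_val (lognE p `|numq q|) (negPf pn) !andbF sub0r opprK -exprnP.
rewrite exprn_egt1 // ?ltr1n ?prime_gt1 //.
by rewrite -lt0n logn_gt0 mem_primes p_pr pd absz_gt0 denq_neq0.
Qed.

Lemma padic_absD q r : padic_abs (q + r) <= Num.max (padic_abs q) (padic_abs r).
Proof.
wlog qr : q r / padic_abs q <= padic_abs r => [H|].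
  by case/orP: (le_total (padic_abs q) (padic_abs r)) => /H //;
    rewrite addrC maxC.
rewrite (max_idPr qr).
have [r0|r0] := eqVneq r 0.
  by move: qr; rewrite r0 padic_abs0 addr0.
suff H s : padic_abs s <= 1 -> padic_abs (s + 1) <= 1.
  have -> : q + r = (q / r + 1) * r by rewrite mulrDl mul1r divfK.
  rewrite padic_absM ger_pMl ?padic_abs_gt0 //; apply: H.
  by rewrite padic_absM padic_absV ler_pdivrMr ?padic_abs_gt0 ?mul1r.
move=> /padic_abs_le1P sd.
have -> : s + 1 = (numq s + denq s)%:Q / (denq s)%:Q.
  by rewrite intrD mulrDl divq_num_den divff // intr_eq0 denq_neq0.
rewrite padic_absM padic_absV.
have -> : padic_abs (denq s)%:~R = 1.
  rewrite /padic_abs intr_eq0 (negPf (denq_neq0 s)) -[_%:~R]divr1.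
  rewrite (@padic_val_frac (denq s) 1) ?denq_neq0 //.
  by rewrite logn1 subr0 lognE (negPf sd) !andbF.
by rewrite invr1 mulr1 padic_abs_int.
Qed.

Lemma padic_abs_triangle q r :
  padic_abs (q + r) <= padic_abs q + padic_abs r.
Proof.
by apply: le_trans (padic_absD _ _) _;
  rewrite ge_max lerDl lerDr !padic_abs_ge0.
Qed.

Lemma padic_absB_sym q r : padic_abs (q - r) = padic_abs (r - q).
Proof. by rewrite -padic_absN opprB. Qed.

Lemma padic_abs_eq q r : padic_abs (q - r) < padic_abs r ->
  padic_abs q = padic_abs r.
Proof.
move=> h; apply/eqP; rewrite eq_le; apply/andP; split.
  rewrite -[in leLHS](subrK r q); apply: le_trans (padic_absD _ _) _.
  by rewrite ge_max lexx ltW.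
rewrite leNgt; apply/negP => qr.
have := padic_absD (r - q) q; rewrite subrK leNgt => /negP; apply.
by rewrite gt_max qr padic_absB_sym h.
Qed.

End AbsoluteValue.

(* Q_p is the completion of Q for padic_abs: Cauchy sequences of rationals    *)
(* modulo null sequences. The field R of reals is a parameter of the type     *)
(* because it carries the metricType R structure; padic_norm_ratr fixes the   *)
(* normalization of the absolute value.                                       *)
Section Completion.
Context (R : realType) (p : nat) (p_pr : prime p).
Local Notation abs := (padic_abs R p).

Definition padic_cauchy (u : nat -> rat) : Prop :=
  forall eps : R, 0 < eps -> exists N, forall m n,
    (N <= m)%N -> (N <= n)%N -> abs (u m - u n) < eps.

Definition padic_null (u : nat -> rat) : Prop :=
  forall eps : R, 0 < eps -> exists N, forall n, (N <= n)%N -> abs (u n) < eps.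

Lemma padic_cauchy_bounded u : padic_cauchy u ->
  exists2 M : R, 0 < M & forall n, abs (u n) <= M.
Proof.
move=> /(_ 1 ltr01) [N HN].
pose M := \sum_(i < N.+1) abs (u i) + 1.
have S0 : 0 <= \sum_(i < N.+1) abs (u i).
  by apply: sumr_ge0 => i _; exact: padic_abs_ge0.
have leM (i : nat) : (i <= N)%N -> abs (u i) <= M.
  move=> iN; rewrite /M (bigD1 (Ordinal (iN : (i < N.+1)%N))) //= -addrA lerDl.
  by rewrite addr_ge0 ?ler01 // sumr_ge0 // => j _; exact: padic_abs_ge0.
exists M => [|n]; first by rewrite ltr_wpDl.
have [/leM//|/ltnW Nn] := leqP n N.
rewrite -(subrK (u N) (u n)); apply: le_trans (padic_absD _ p_pr _ _) _.
rewrite ge_max leM // andbT (le_trans (ltW (HN _ _ Nn (leqnn _)))) //.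
by rewrite lerDr.
Qed.

Definition cauchy_pred : {pred nat -> rat} := fun u => `[< padic_cauchy u >].

Lemma cauchy_pred_subring : subring_closed cauchy_pred.
Proof.
split.
- apply/asboolP => eps e0; exists 0%N => m n _ _.
  by rewrite subrr padic_abs0.
- move=> u v /asboolP cu /asboolP cv; apply/asboolP => eps e0.
  have [N HN] := cu _ e0; have [M HM] := cv _ e0.
  exists (maxn N M) => m n; rewrite !geq_max => /andP[Nm Mm] /andP[Nn Mn].
  have -> : (u - v) m - (u - v) n = (u m - u n) + (v n - v m).
    by rewrite !fctE opprB [v n - u n]addrC addrACA [- v m + _]addrC.
  apply: le_lt_trans (padic_absD _ p_pr _ _) _.
  by rewrite gt_max HN // HM.
- move=> u v /asboolP cu /asboolP cv; apply/asboolP => eps e0.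
  have [A A0 HA] := padic_cauchy_bounded cu.
  have [B B0 HB] := padic_cauchy_bounded cv.
  have [N HN] := cu _ (divr_gt0 e0 B0); have [M HM] := cv _ (divr_gt0 e0 A0).
  exists (maxn N M) => m n; rewrite !geq_max => /andP[Nm Mm] /andP[Nn Mn].
  rewrite !fctE.
  have -> : u m * v m - u n * v n = u m * (v m - v n) + (u m - u n) * v n.
    by rewrite mulrBr mulrBl addrA subrK.
  apply: le_lt_trans (padic_absD _ p_pr _ _) _.
  rewrite gt_max !padic_absM //; apply/andP; split.
    apply: le_lt_trans (_ : A * abs (v m - v n) < _).
      by rewrite ler_wpM2r ?padic_abs_ge0.
    by rewrite mulrC -ltr_pdivlMr // HM.
  apply: le_lt_trans (_ : abs (u m - u n) * B < _).
    by rewrite ler_wpM2l ?padic_abs_ge0.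
  by rewrite -ltr_pdivlMr // HN.
Qed.

HB.instance Definition _ :=
  GRing.isSubringClosed.Build (nat -> rat) cauchy_pred cauchy_pred_subring.

Record cauchy_seq := CauchySeq {
  cauchy_val :> nat -> rat ;
  cauchy_valP : cauchy_val \in cauchy_pred
}.

HB.instance Definition _ := [isSub for cauchy_val].
HB.instance Definition _ := [Choice of cauchy_seq by <:].
HB.instance Definition _ := [SubChoice_isSubComNzRing of cauchy_seq by <:].

Definition null_ideal : {pred cauchy_seq} :=
  fun u => `[< padic_null (cauchy_val u) >].

Lemma null_ideal_closed : idealr_closed null_ideal.
Proof.
split.
- by apply/asboolP => eps e0; exists 0%N => n _; rewrite padic_abs0.
- apply/asboolP => /(_ 1 ltr01) [N /(_ N (leqnn N))].
  by rewrite padic_abs1 ltxx.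
- move=> a u v /asboolP nu /asboolP nv; apply/asboolP => eps e0.
  have [A A0 HA] := padic_cauchy_bounded (asboolP _ (cauchy_valP a)).
  have [N HN] := nu _ (divr_gt0 e0 A0); have [M HM] := nv _ e0.
  exists (maxn N M) => n; rewrite !geq_max => /andP[Nn Mn].
  apply: le_lt_trans (padic_absD _ p_pr _ _) _.
  rewrite gt_max HM // andbT padic_absM //.
  apply: le_lt_trans (_ : A * abs (u n) < _).
    by rewrite ler_wpM2r ?padic_abs_ge0.
  by rewrite mulrC -ltr_pdivlMr // HN.
Qed.

HB.instance Definition _ :=
  isIdealr.Build cauchy_seq null_ideal null_ideal_closed.

Definition Qp := {ideal_quot null_ideal}.
HB.instance Definition _ := GRing.ComNzRing.on Qp.

Implicit Types (u v : cauchy_seq) (x y : Qp).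

Lemma Qp_eq0P u : \pi_Qp u = 0 <-> padic_null u.
Proof.
have -> : (\pi_Qp u = 0) <-> (u \in null_ideal).
  have -> : 0 = \pi_Qp 0 by rewrite piE.
  split => [/eqP|h]; first by rewrite -Quotient.idealrBE subr0.
  by apply/eqP; rewrite -Quotient.idealrBE subr0.
by split => /asboolP.
Qed.

Lemma padic_abs_stable u : ~ padic_null u ->
  exists2 N, 0 < abs (u N) & forall n, (N <= n)%N -> abs (u n) = abs (u N).
Proof.
move=> /existsNP[eps /not_implyP[e0 /forallNP hN]].
have [N HN] := asboolP _ (cauchy_valP u) _ e0.
have /existsNP[n0 /not_implyP[Nn0 /negP]] := hN N.
rewrite -leNgt => en0.
have hn n : (N <= n)%N -> abs (u n) = abs (u n0).
  move=> Nn; apply: (padic_abs_eq p_pr).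
  exact: lt_le_trans (HN _ _ Nn Nn0) en0.
exists N => [|n Nn]; first by rewrite hn // (lt_le_trans e0 en0).
by rewrite !hn.
Qed.

Lemma Qp_inv_ex x : x != 0 -> exists y, y * x = 1.
Proof.
elim/quotW: x => u /eqP u0.
have nu : ~ padic_null u by move=> /Qp_eq0P.
have [N c0 HN] := padic_abs_stable nu; set c := abs (u N) in c0 HN.
have un0 n : (N <= n)%N -> u n != 0.
  by move=> /HN e; rewrite -(padic_abs_eq0 R p_pr) e gt_eqF.
have cv : (fun n => (u n)^-1) \in cauchy_pred.
  apply/asboolP => eps e0.
  have [M HM] := asboolP _ (cauchy_valP u) _ (mulr_gt0 e0 (mulr_gt0 c0 c0)).
  exists (maxn N M) => m n; rewrite !geq_max => /andP[Nm Mm] /andP[Nn Mn].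
  have -> : (u m)^-1 - (u n)^-1 = (u n - u m) / (u m * u n).
    rewrite mulrBl invfM [(u m)^-1 * _]mulrC mulVKf ?un0 //; congr (_ - _).
    by rewrite [(u n)^-1 * _]mulrC mulVKf ?un0.
  rewrite padic_absM // padic_absV // padic_absM // !HN //.
  by rewrite ltr_pdivrMr ?mulr_gt0 // HM.
exists (\pi_Qp (CauchySeq cv)).
apply/eqP; rewrite -subr_eq0; apply/eqP.
have -> : \pi_Qp (CauchySeq cv) * \pi_Qp u - 1 = \pi_Qp (CauchySeq cv * u - 1).
  by rewrite !piE.
apply/Qp_eq0P => eps e0; exists N => n Nn.
have -> : (CauchySeq cv * u - 1 : cauchy_seq) n = (u n)^-1 * u n - 1 by [].
by rewrite mulVf ?un0 // subrr padic_abs0.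
Qed.

Definition Qp_inv x : Qp := xget 0 [set y | y * x = 1].

Lemma Qp_mulVf x : x != 0 -> Qp_inv x * x = 1.
Proof. by move=> /Qp_inv_ex[y yx]; exact: (xgetI 0 (yx : [set y | y * x = 1] y)). Qed.

Lemma Qp_inv0 : Qp_inv 0 = 0.
Proof.
apply: xgetPN => y /=; rewrite mulr0; apply/eqP.
by rewrite eq_sym oner_neq0.
Qed.

HB.instance Definition _ := GRing.ComNzRing_isField.Build Qp Qp_mulVf Qp_inv0.

Definition padic_norm x : R := limn (fun n => abs ((repr x : cauchy_seq) n)).

Lemma padic_abs_cvg u : cvgn (fun n => abs (u n)).
Proof.
have [nu|/padic_abs_stable[N _ HN]] := pselect (padic_null u).
  apply/cvg_ex; exists 0; apply/cvgrPdist_lt => eps e0.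
  have [N HN] := nu _ e0; exists N => // n /= Nn.
  by rewrite sub0r normrN ger0_norm ?padic_abs_ge0 // HN.
apply/cvg_ex; exists (abs (u N)); apply: cvg_near_cst.
by exists N => // n /= /HN ->.
Qed.

Lemma padic_norm_pi u : padic_norm (\pi_Qp u) = limn (fun n => abs (u n)).
Proof.
rewrite /padic_norm; set v := repr _.
have : padic_null (v - u).
  by apply/Qp_eq0P; rewrite [LHS]raddfB /= reprK subrr.
move=> nvu.
have h : (fun n => abs (v n) - abs (u n)) @ \oo --> (0 : R).
  apply/cvgrPdist_lt => eps e0; have [N HN] := nvu _ e0.
  exists N => // n /= Nn; have {HN} := HN n Nn.
  rewrite (_ : (v - u) n = v n - u n) // sub0r normrN => H.
  have H1 := padic_abs_triangle R p_pr (v n - u n) (u n).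
  have H2 := padic_abs_triangle R p_pr (u n - v n) (v n).
  rewrite subrK in H1; rewrite subrK padic_absB_sym in H2.
  rewrite ltr_norml ltrNl opprB; apply/andP.
  by split; apply: le_lt_trans H; rewrite lerBlDr.
apply: cvg_lim => //; rewrite -[limn _]add0r.
suff <- : (fun n => abs (v n) - abs (u n)) + (fun n => abs (u n)) =
  (fun n => abs (v n)) by apply: cvgD h (@padic_abs_cvg u).
by apply/funext => n; rewrite fctE subrK.
Qed.

Lemma padic_norm_ge0 x : 0 <= padic_norm x.
Proof.
rewrite /padic_norm; apply: limr_ge; first exact: padic_abs_cvg.
by near=> n; exact: padic_abs_ge0.
Unshelve. all: by end_near. Qed.

Lemma padic_norm0 : padic_norm 0 = 0.
Proof.
have -> : 0 = \pi_Qp 0 by rewrite piE.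
by rewrite padic_norm_pi (_ : (fun _ => _) = cst 0) ?lim_cst.
Qed.

Lemma padic_norm_eq0 x : padic_norm x = 0 -> x = 0.
Proof.
elim/quotW: x => u; rewrite padic_norm_pi => u0.
have [/Qp_eq0P//|/padic_abs_stable[N c0 HN]] := pselect (padic_null u).
have : (fun n => abs (u n)) @ \oo --> abs (u N).
  by apply: cvg_near_cst; exists N => // n /= /HN ->.
by move/(cvg_lim (@Rhausdorff R)) => c; rewrite -c u0 ltxx in c0.
Qed.

Lemma padic_normN x : padic_norm (- x) = padic_norm x.
Proof.
elim/quotW: x => u; rewrite -[- _]raddfN !padic_norm_pi.
suff -> : (fun n => abs ((- u : cauchy_seq) n)) = (fun n => abs (u n)) by [].
by apply/funext => n; rewrite -[RHS]padic_absN.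
Qed.

Lemma padic_normM x y : padic_norm (x * y) = padic_norm x * padic_norm y.
Proof.
elim/quotW: x => u; elim/quotW: y => v.
have -> : \pi_Qp u * \pi_Qp v = \pi_Qp (u * v) by rewrite !piE.
rewrite !padic_norm_pi -limM; try exact: padic_abs_cvg.
suff -> : (fun n => abs ((u * v : cauchy_seq) n)) =
  (fun n => abs (u n)) * (fun n => abs (v n)) by [].
by apply/funext => n; rewrite fctE -padic_absM.
Qed.

Lemma padic_normD x y :
  padic_norm (x + y) <= Num.max (padic_norm x) (padic_norm y).
Proof.
elim/quotW: x => u; elim/quotW: y => v; rewrite -[_ + _]raddfD.
rewrite !padic_norm_pi; apply/ler_addgt0Pl => e e0.
have au := @padic_abs_cvg u; have av := @padic_abs_cvg v.
set M := Num.max _ _.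
have uM : limn (fun n => abs (u n)) < e + M.
  by rewrite ltr_pwDl // le_max lexx.
have vM : limn (fun n => abs (v n)) < e + M.
  by rewrite ltr_pwDl // le_max lexx orbT.
apply: limr_le; first exact: padic_abs_cvg.
near=> n; apply: le_trans (padic_absD _ p_pr _ _) _; rewrite ge_max.
apply/andP; split; near: n.
  exact: cvgr_le au _ uM.
exact: cvgr_le av _ vM.
Unshelve. all: by end_near. Qed.

Lemma padic_norm_triangle y x z :
  padic_norm (x - z) <= padic_norm (x - y) + padic_norm (y - z).
Proof.
have -> : x - z = (x - y) + (y - z) by rewrite addrA subrK.
apply: le_trans (padic_normD _ _) _.
by rewrite ge_max lerDl lerDr !padic_norm_ge0.
Qed.

Lemma padic_norm_xx x : padic_norm (x - x) = 0.
Proof. by rewrite subrr padic_norm0. Qed.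

Lemma padic_norm_inj x y : padic_norm (x - y) = 0 -> x = y.
Proof. by move/padic_norm_eq0/eqP; rewrite subr_eq0 => /eqP. Qed.

Lemma padic_norm_sym x y : padic_norm (x - y) = padic_norm (y - x).
Proof. by rewrite -padic_normN opprB. Qed.

HB.instance Definition _ := isMetric.Build R Qp
  padic_norm_xx padic_norm_inj padic_norm_sym padic_norm_triangle.

Lemma Qp_mdistE x y : mdist x y = padic_norm (x - y).
Proof. by []. Qed.

Lemma padic_norm_ratr (q : rat) : padic_norm (ratr q) = abs q.
Proof.
have norm1 : padic_norm 1 = 1.
  have -> : 1 = \pi_Qp 1 by rewrite piE.
  rewrite padic_norm_pi.
  suff -> : (fun n => abs ((1 : cauchy_seq) n)) = cst 1 by exact: lim_cst.
  by apply/funext => n; exact: padic_abs1.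
have normV (x : Qp) : padic_norm x^-1 = (padic_norm x)^-1.
  have [->|x0] := eqVneq x 0; first by rewrite invr0 padic_norm0 invr0.
  have nx0 : padic_norm x != 0 by apply: contra_neq x0 => /padic_norm_eq0.
  by apply: (mulfI nx0); rewrite -padic_normM !divff.
have norm_int (m : int) : padic_norm m%:~R = abs m%:~R.
  have -> : m%:~R = \pi_Qp m%:~R by rewrite rmorph_int.
  rewrite padic_norm_pi.
  suff -> : (fun n => abs ((m%:~R : cauchy_seq) n)) = cst (abs m%:~R).
    exact: lim_cst.
  apply/funext => n /=; congr (abs _).
  have natE k : (k%:R : cauchy_seq) n = k%:R.
    by elim: k => // k IH; rewrite !mulrS -IH.
  by case: m => k; [exact: natE|exact: (congr1 -%R (natE k.+1))].
rewrite /ratr padic_normM normV !norm_int -padic_absV // -padic_absM //.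
by rewrite divq_num_den.
Qed.

End Completion.

Section Dynamics.
Context (R : realType) (X : metricType R).
Implicit Types f g h : X -> X.

Definition inverse_homeo f g : Prop :=
  [/\ cancel f g, cancel g f, continuous f & continuous g].

Definition homeomorphism f : Prop := exists g, inverse_homeo f g.

Definition isometry f : Prop := forall x y, mdist (f x) (f y) = mdist x y.

(* f^n for n : int, where g is the inverse of f (Negz m stands for -(m+1)) *)
Definition int_iter f g (n : int) : X -> X :=
  match n with Posz m => iter m f | Negz m => iter m.+1 g end.

Definition shadowing f : Prop := exists2 g, inverse_homeo f g &
  forall eps : R, 0 < eps -> exists2 delta : R, 0 < delta &
    forall x : int -> X, (forall n, mdist (f (x n)) (x (n + 1)) <= delta) ->
      exists y, forall n, mdist (x n) (int_iter f g n y) <= eps.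

Definition conjugate_by h f g : Prop := homeomorphism h /\ f \o h = h \o g.

Definition topologically_conjugate f g : Prop := exists h, conjugate_by h f g.

End Dynamics.

Section PadicDynamics.
Context (R : realType) (p : nat) (p_pr : prime p).
Local Notation Qp := (Qp R p_pr).
Implicit Types (f psi : Qp -> Qp) (c e : Qp).

(* ereal_sup, because the real sup of an unbounded set is 0 by convention *)
Definition small_perturbation (eps : R) psi : Prop :=
  (forall x y, mdist (psi x) (psi y) <= eps * mdist x y) /\
  (ereal_sup [set (padic_norm (psi x))%:E | x in [set: Qp]] < eps%:E)%E.

Definition lipschitz_structurally_stable f : Prop := continuous f /\
  exists2 eps : R, 0 < eps & forall psi, small_perturbation eps psi ->
    topologically_conjugate f (f \+ psi).

Definition isometrically_lipschitz_structurally_stable f : Prop :=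
  exists2 eps : R, 0 < eps & forall psi, small_perturbation eps psi ->
    exists2 h, isometry h & conjugate_by h f (f \+ psi).

Definition affine c e (z : Qp) : Qp := c * z + e.

End PadicDynamics.

(* Main.v *)
(* Let f be an invertible map multiplying distances by r >= 1. If r > 1, a forward
   C-pseudo-orbit (x_n) is shadowed at distance C by the orbit of lim f^-n(x_n); if
   r = 1, or for the inverse of f, any point C-close to x_0 shadows, by the
   ultrametric inequality. Together they give shadowing. If |a| <> 1, a
   perturbation g = f + psi with Lipschitz constant below |a| still multiplies
   distances by |a|, and is onto by the contraction principle; after passing to
   inverses if needed, r > 1 and h(x) is the unique point whose f-orbit stays at
   bounded distance from the g-orbit of x. Comparing d(h x, h y) with d(x, y)
   after n steps shows that h is an isometry. Finally, after moving the fixed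
   point of f to 0, write a = v p^-k with |v| = 1: the map z |-> v^(m %/ k) z,
   where |z| = p^m, is an isometry that conjugates z |-> p^-k z to z |-> a z,
   since z |-> p^-k z adds k to m. *)
Require Import Defs.
From mathcomp Require Import all_boot all_order all_algebra.
From mathcomp Require Import generic_quotient ring_quotient.
From mathcomp Require Import all_classical all_reals all_analysis.

Local Open Scope ring_scope.
Local Open Scope quotient_scope.
Local Open Scope classical_set_scope.

Import Order.TTheory GRing.Theory Num.Theory.
Import numFieldTopology.Exports.

Set Implicit Arguments.
Unset Strict Implicit.
Unset Printing Implicit Defensive.

(** * Maps multiplying distances by a constant *)

Section Scaling.
Context (R : realType) (X : metricType R).
Implicit Types (f g h : X -> X) (r : R).

Definition scaling r f : Prop := forall x y, mdist (f x) (f y) = r * mdist x y.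

Lemma mdist_small_eq (x y : X) :
  (forall eps : R, 0 < eps -> mdist x y <= eps) -> x = y.
Proof.
move=> H; apply: mdist_positivity; apply/eqP; rewrite eq_le mdist_ge0 andbT.
by apply/ler_addgt0Pl => e e0; rewrite addr0 H.
Qed.

Lemma scaling_iter r f n : scaling r f -> scaling (r ^+ n) (iter n f).
Proof.
move=> fr; elim: n => [|n IH] x y /=; first by rewrite expr0 mul1r.
by rewrite fr IH mulrA exprS.
Qed.

Lemma scaling_continuous r f : 0 < r -> scaling r f -> continuous f.
Proof.
move=> r0 fr x; apply/metricType_numDomainType.cvgrPdist_lt => e e0.
near=> y; rewrite fr mulrC -ltr_pdivlMr //; near: y.
exact: metricType_numDomainType.cvgr_dist_lt cvg_id _ (divr_gt0 e0 r0).
Unshelve. all: by end_near. Qed.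

Lemma scaling_cancel r f g : r != 0 -> cancel g f -> scaling r f ->
  scaling r^-1 g.
Proof. by move=> r0 gK fr x y; rewrite -{2}(gK x) -{2}(gK y) fr mulKf. Qed.

Lemma scaling_inverse_homeo r f g : 0 < r -> cancel f g -> cancel g f ->
  scaling r f -> inverse_homeo f g.
Proof.
move=> r0 fK gK fr; split => //; first exact: scaling_continuous fr.
apply: (@scaling_continuous r^-1); rewrite ?invr_gt0 //.
by apply: scaling_cancel fr => //; rewrite gt_eqF.
Qed.

Lemma scaling_inj r f : r != 0 -> scaling r f -> injective f.
Proof.
move=> r0 fr x y fxy; apply: mdist_positivity; apply: (mulfI r0).
by rewrite -fr fxy mdistxx mulr0.
Qed.

Lemma iterK f g n : cancel f g -> cancel (iter n f) (iter n g).
Proof. by move=> fK; elim: n => // n IH x; rewrite iterSr iterS fK IH. Qed.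

End Scaling.

(** * Completeness of the p-adic numbers *)

Section Padic.
Context (R : realType) (p : nat) (p_pr : prime p).
Local Notation Qp := (Qp R p_pr).
Local Notation abs := (padic_abs R p).

Lemma Qp_ultrametric (y x z : Qp) :
  mdist x z <= Num.max (mdist x y) (mdist y z).
Proof.
by rewrite !Qp_mdistE; have := padic_normD (x - y) (y - z); rewrite addrA subrK.
Qed.

Lemma padic_norm_eq0E (x : Qp) : (padic_norm x == 0) = (x == 0).
Proof.
apply/eqP/eqP => [/padic_norm_eq0//|->]; exact: padic_norm0.
Qed.

Lemma padic_norm_gt0 (x : Qp) : (0 < padic_norm x) = (x != 0).
Proof. by rewrite lt0r padic_norm_eq0E padic_norm_ge0 andbT. Qed.

Lemma padic_norm1 : padic_norm (1 : Qp) = 1.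
Proof.
have /mulIf : padic_norm (1 : Qp) != 0 by rewrite padic_norm_eq0E oner_eq0.
by apply; rewrite -padic_normM !mul1r.
Qed.

Lemma padic_normV (x : Qp) : padic_norm x^-1 = (padic_norm x)^-1.
Proof.
have [->|x0] := eqVneq x 0; first by rewrite invr0 padic_norm0 invr0.
have nx0 : padic_norm x != 0 by rewrite padic_norm_eq0E.
by apply: (mulfI nx0); rewrite -padic_normM !divff // padic_norm1.
Qed.

Lemma padic_normXz (x : Qp) (n : int) : padic_norm (x ^ n) = padic_norm x ^ n.
Proof.
have normX m : padic_norm (x ^+ m) = padic_norm x ^+ m.
  by elim: m => [|m IH]; rewrite ?expr0 ?padic_norm1 // !exprS padic_normM IH.
by case: n => n; rewrite ?NegzE -?exprnN ?padic_normV normX.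
Qed.

Lemma padic_norm_lt_eq (x y : Qp) : padic_norm x < padic_norm y ->
  padic_norm (y - x) = padic_norm y.
Proof.
move=> xy; apply/eqP; rewrite eq_le; apply/andP; split.
  by apply: le_trans (padic_normD _ _) _; rewrite ge_max lexx padic_normN ltW.
have := padic_normD (y - x) x; rewrite subrK le_max => /orP[//|].
by rewrite leNgt xy.
Qed.

(** The value group is discrete: a Cauchy sequence that is not null has eventually constant absolute
    value, so the norm is that of a nonzero rational. *)
Lemma padic_norm_pow (x : Qp) : x != 0 ->
  exists m : int, padic_norm x = p%:R ^ m.
Proof.
elim/quotW: x => u u0.
have nu : ~ padic_null R p (cauchy_val u).
  by move=> /Qp_eq0P e; rewrite e eqxx in u0.
have [N N0 HN] := padic_abs_stable p_pr nu.
exists (- padic_val p (cauchy_val u N)).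
have -> : p%:R ^ (- padic_val p (cauchy_val u N)) = abs (cauchy_val u N).
  rewrite /padic_abs ifN //; apply: contraTneq N0 => ->.
  by rewrite padic_abs0 ltxx.
rewrite padic_norm_pi; apply: cvg_lim; first exact: Rhausdorff.
by apply: cvg_near_cst; exists N => // n /= Nn; exact: HN.
Qed.

Lemma padic_norm_le (u : cauchy_seq R p) (e : R) N :
  (forall n, (N <= n)%N -> abs (cauchy_val u n) <= e) ->
  padic_norm (\pi_Qp u) <= e.
Proof.
move=> H; rewrite padic_norm_pi; apply: limr_le; first exact: padic_abs_cvg.
by exists N.
Qed.

Lemma cst_cauchy (q : rat) : (fun=> q) \in cauchy_pred R p.
Proof.
by apply/asboolP => e e0; exists 0%N => m n _ _; rewrite subrr padic_abs0.
Qed.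

Definition Qp_cst (q : rat) : Qp := \pi_Qp (CauchySeq (cst_cauchy q)).

Lemma Qp_mdist_cst (q r : rat) : mdist (Qp_cst q) (Qp_cst r) = abs (q - r).
Proof.
rewrite Qp_mdistE -raddfB padic_norm_pi.
apply: cvg_lim; first exact: Rhausdorff.
by apply: cvg_near_cst; exists 0%N.
Qed.

Lemma Qp_dense (x : Qp) (e : R) : 0 < e ->
  exists q : rat, mdist x (Qp_cst q) <= e.
Proof.
move=> e0; elim/quotW: x => u.
have [N HN] := asboolP _ (cauchy_valP u) e e0.
exists (cauchy_val u N); rewrite Qp_mdistE -raddfB.
by apply: (@padic_norm_le _ _ N) => n Nn; exact/ltW/HN.
Qed.

Lemma geometric_eventually (C l e : R) : 0 < l < 1 -> 0 < e ->
  exists N, C * l ^+ N <= e.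
Proof.
move=> /andP[l0 l1] e0.
have : (fun n => C * l ^+ n) @ \oo --> (0 : R).
  by apply: cvg_geometric; rewrite gtr0_norm.
move=> /cvgrPdist_le/(_ e e0)[N _ /(_ N (leqnn N))] /=.
by rewrite sub0r normrN => /(le_trans (ler_norm _)); exists N.
Qed.

(** Completeness, in the form used below. By the ultrametric inequality the bound on one step covers
    all later terms, so no geometric series is summed; rationals [q n] within [C * l ^+ n] of [x n]
    form a Cauchy sequence whose class is the limit. *)
Lemma Qp_geometric_cvg (x : nat -> Qp) (C l : R) : 0 < C -> 0 < l < 1 ->
  (forall n, mdist (x n.+1) (x n) <= C * l ^+ n) ->
  exists y, forall n, mdist y (x n) <= C * l ^+ n.
Proof.
move=> C0 l01 Hx; have /andP[l0 l1] := l01.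
have Cl n : 0 < C * l ^+ n by rewrite mulr_gt0 ?exprn_gt0.
have Cl_decr m n : (n <= m)%N -> C * l ^+ m <= C * l ^+ n.
  by move=> nm; rewrite ler_pM2l // ler_wiXn2l // ltW.
have xx m n : (n <= m)%N -> mdist (x m) (x n) <= C * l ^+ n.
  elim: m => [|m IH]; first by rewrite leqn0 => /eqP ->; rewrite mdistxx ltW.
  rewrite leq_eqVlt => /orP[/eqP ->|nm]; first by rewrite mdistxx ltW.
  apply: le_trans (Qp_ultrametric (x m) _ _) _; rewrite ge_max IH // andbT.
  by apply: le_trans (Hx m) _; exact: Cl_decr.
have [q Hq] := choice (fun n => Qp_dense (x n) (Cl n)).
have qq m n : (n <= m)%N -> abs (q m - q n) <= C * l ^+ n.
  move=> nm; rewrite -Qp_mdist_cst.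
  apply: le_trans (Qp_ultrametric (x m) _ _) _.
  rewrite ge_max metric_sym (le_trans (Hq m)) ?Cl_decr //=.
  by apply: le_trans (Qp_ultrametric (x n) _ _) _; rewrite ge_max xx //=.
have qc : q \in cauchy_pred R p.
  apply/asboolP => e e0.
  (* Halving [e] yields the strict inequality required of a Cauchy sequence. *)
  have [N HN] := geometric_eventually C l01 (divr_gt0 e0 (ltr0n R 2)).
  exists N => m n Nm Nn; wlog nm : m n Nm Nn / (n <= m)%N => [H|].
    have [/H->//|/ltnW/H] := leqP n m.
    by rewrite padic_absB_sym => ->.
  apply: le_lt_trans (qq _ _ nm) _; apply: le_lt_trans (Cl_decr _ _ Nn) _.
  by apply: le_lt_trans HN _; rewrite ltr_pdivrMr // ltr_pMr // ltr1n.
exists (\pi_Qp (CauchySeq qc) : Qp) => n.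
apply: le_trans (Qp_ultrametric (Qp_cst (q n)) _ _) _.
rewrite ge_max [mdist _ (x n)]metric_sym Hq andbT Qp_mdistE -raddfB.
apply: (@padic_norm_le _ _ n) => m nm /=.
exact: qq.
Qed.

End Padic.

(** * Shadowing and conjugacy of scaling maps *)

Section ScalingMaps.
Context (R : realType) (p : nat) (p_pr : prime p).
Local Notation Qp := (Qp R p_pr).
Implicit Types (f g h : Qp -> Qp) (C l r : R).

Lemma Qp_contraction_fixpoint l f : 0 < l < 1 ->
  (forall x y, mdist (f x) (f y) <= l * mdist x y) -> exists x, f x = x.
Proof.
move=> l01 fl; have /andP[l0 l1] := l01.
(* Adding 1 keeps [C] positive even when 0 is already fixed. *)
pose C := mdist (f 0) 0 + 1.
have C0 : 0 < C by rewrite ltr_wpDl // mdist_ge0.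
have fC n : mdist (iter n.+1 f 0) (iter n f 0) <= C * l ^+ n.
  elim: n => [|n IH]; first by rewrite mulr1 lerDl.
  by apply: le_trans (fl _ _) _; rewrite exprS mulrCA ler_pM2l.
have [y Hy] := Qp_geometric_cvg C0 l01 fC.
exists y; apply: mdist_small_eq => e e0.
have [N HN] := geometric_eventually C l01 e0; apply: le_trans HN.
apply: le_trans (Qp_ultrametric (iter N.+1 f 0) _ _) _; rewrite ge_max.
apply/andP; split.
  apply: le_trans (fl _ _) _; apply: le_trans (Hy N).
  by rewrite ler_piMl ?mdist_ge0 // ltW.
rewrite metric_sym; apply: le_trans (Hy _) _.
by rewrite ler_pM2l // exprS ler_piMl ?exprn_ge0 // ltW.
Qed.

(** Errors do not accumulate: the new error and the transported one, each at most [C], combine by a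
    maximum. *)
Lemma nonexpanding_shadow r f C (y : Qp) (x : nat -> Qp) : r <= 1 ->
  scaling r f -> (forall n, mdist (f (x n)) (x n.+1) <= C) ->
  mdist y (x 0%N) <= C -> forall n, mdist (iter n f y) (x n) <= C.
Proof.
move=> r1 fr xC y0; elim=> [//|n IH] /=.
apply: le_trans (Qp_ultrametric (f (x n)) _ _) _; rewrite ge_max xC andbT fr.
by apply: le_trans IH; rewrite ler_piMl ?mdist_ge0.
Qed.

(** For [1 < r] the points [iter n f' (x n)] converge geometrically, and applying [iter n f] to the
    limit restores the bound [C]. For [r = 1] the starting point [x 0] itself works. *)
Lemma expanding_shadow r f f' C (x : nat -> Qp) : 1 <= r -> 0 < C ->
  cancel f' f -> scaling r f -> (forall n, mdist (f (x n)) (x n.+1) <= C) ->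
  exists y, forall n, mdist (iter n f y) (x n) <= C.
Proof.
rewrite le_eqVlt => /orP[/eqP r1 C0 f'K fr xC|r1 C0 f'K fr xC].
  exists (x 0%N) => n; apply: (nonexpanding_shadow _ fr xC).
    by rewrite r1.
  by rewrite mdistxx ltW.
have r0 : 0 < r by apply: lt_trans r1.
have f'r : scaling r^-1 f' by apply: scaling_cancel fr; rewrite ?gt_eqF.
have [||y Hy] := @Qp_geometric_cvg R p p_pr (fun n => iter n f' (x n)) C r^-1 C0.
- by rewrite invr_gt0 r0 invf_lt1.
- move=> n; rewrite iterSr (scaling_iter _ f'r) mulrC.
  rewrite ler_pM2r ?exprn_gt0 ?invr_gt0 //.
  rewrite -(ler_pM2l r0) -fr f'K metric_sym; apply: le_trans (xC n) _.
  by rewrite ler_peMl // ltW.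
exists y => n.
rewrite -[x n in leLHS](iterK n f'K) (scaling_iter n fr).
by have := Hy n; rewrite exprVn ler_pdivlMr ?exprn_gt0 // mulrC.
Qed.

(** Separations grow like [r ^+ n], so one that stays bounded is zero. *)
Lemma expanding_expansive r f C (x y : Qp) : 1 < r -> scaling r f ->
  (forall n, mdist (iter n f x) (iter n f y) <= C) -> x = y.
Proof.
move=> r1 fr H; apply: mdist_small_eq => e e0.
have r0 : 0 < r by apply: lt_trans r1.
have [|N HN] := @geometric_eventually R C r^-1 e _ e0.
  by rewrite invr_gt0 r0 invf_lt1.
apply: le_trans HN; rewrite exprVn ler_pdivlMr ?exprn_gt0 // mulrC.
by rewrite -(scaling_iter N fr).
Qed.

(** The forward half provides [y]; backwards [f'] does not expand, so closeness at time 0 is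
    enough. *)
Lemma two_sided_shadow r f f' C (u v : nat -> Qp) : 1 <= r -> 0 < C ->
  cancel f' f -> scaling r f -> u 0%N = v 0%N ->
  (forall n, mdist (f (u n)) (u n.+1) <= C) ->
  (forall n, mdist (f' (v n)) (v n.+1) <= C) ->
  exists y, forall n, mdist (iter n f y) (u n) <= C /\
                      mdist (iter n f' y) (v n) <= C.
Proof.
move=> r1 C0 f'K fr uv0 uC vC.
have r0 : 0 < r by apply: lt_le_trans r1.
have f'r : scaling r^-1 f' by apply: scaling_cancel fr; rewrite ?gt_eqF.
have [y Hy] := expanding_shadow r1 C0 f'K fr uC.
exists y => n; split=> //; apply: (nonexpanding_shadow _ f'r vC).
  by rewrite invf_le1.
by rewrite -uv0; exact: (Hy 0%N).
Qed.

Lemma scaling_shadowing r f f' : 0 < r -> cancel f f' -> cancel f' f ->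
  scaling r f -> shadowing f.
Proof.
move=> r0 fK f'K fr.
exists f'; first exact: scaling_inverse_homeo fr.
have f'r : scaling r^-1 f' by apply: scaling_cancel fr; rewrite ?gt_eqF.
(* Passing to the inverse divides errors by [r], hence the bound [r * e]. *)
move=> e e0; exists (Num.min e (r * e)); first by rewrite lt_min e0 mulr_gt0.
move=> x Hx.
pose u (n : nat) := x n%:Z; pose v (n : nat) := x (- n%:Z).
have uC n : mdist (f (u n)) (u n.+1) <= e.
  by have := Hx n; rewrite le_min -PoszD addn1 => /andP[].
have vC n : mdist (f' (v n)) (v n.+1) <= e.
  rewrite -[v n.+1]fK f'r ler_pdivrMl // metric_sym /v.
  have := Hx (- n.+1%:Z); rewrite le_min => /andP[_].
  by rewrite -addn1 PoszD opprD subrK.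
have [y Hy] : exists y, forall n, mdist (iter n f y) (u n) <= e /\
                      mdist (iter n f' y) (v n) <= e.
  have [r1|r1] := leP 1 r; first exact: two_sided_shadow fr _ uC vC.
  (* A contraction is handled through its inverse, with past and future exchanged. *)
  have r1' : 1 <= r^-1 by rewrite invf_ge1 // ltW.
  have [//|y Hy] := two_sided_shadow r1' e0 fK f'r _ vC uC.
  by exists y => n; rewrite andC; exact: Hy.
exists y => -[] n; rewrite metric_sym; first by have [] := Hy n.
by have [_] := Hy n.+1; rewrite /v NegzE.
Qed.

(** The [g]-orbit of [x] is a pseudo-orbit of [f], and [h x] is the point whose [f]-orbit shadows
    it. *)
Lemma semiconjugacy r f f' g C : 1 < r -> 0 < C -> cancel f' f ->
  scaling r f -> scaling r g -> (forall x, mdist (f x) (g x) <= C) ->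
  exists h, [/\ forall x n, mdist (iter n f (h x)) (iter n g x) <= C,
    f \o h = h \o g & forall x y, mdist (h x) (h y) <= mdist x y].
Proof.
move=> r1 C0 f'K fr gr fg.
have r0 : 0 < r by apply: lt_trans r1.
have [h Hh] := choice (fun x => expanding_shadow (ltW r1) C0 f'K fr
  (fun n => fg (iter n g x) : mdist _ (iter n.+1 g x) <= C)).
exists h; split=> //.
  (* Both [f (h x)] and [h (g x)] shadow the [g]-orbit of [g x], so expansivity identifies them. *)
  apply/funext => x /=; apply: (expanding_expansive (C := C) r1 fr) => n.
  apply: le_trans (Qp_ultrametric (iter n.+1 g x) _ _) _.
  by rewrite ge_max -iterSr Hh metric_sym iterSr Hh.
move=> x y; have [->|xy] := eqVneq x y; first by rewrite !mdistxx.
have d0 : 0 < mdist x y by rewrite mdist_gt0.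
(* At time [N] the [g]-orbits of [x] and [y] are at least [C] apart; the shadowing errors then
   disappear in the maximum, and dividing by [r ^+ N] gives the estimate without loss. *)
have [|N] := @geometric_eventually R C r^-1 _ _ d0.
  by rewrite invr_gt0 r0 invf_lt1.
have rN0 : 0 < r ^+ N by rewrite exprn_gt0.
rewrite exprVn ler_pdivrMr // mulrC -(scaling_iter N gr) => CN.
rewrite -(ler_pM2l rN0) -(scaling_iter N fr) -(scaling_iter N gr).
apply: le_trans (Qp_ultrametric (iter N g x) _ _) _; rewrite ge_max.
rewrite (le_trans (Hh _ _)) //=.
apply: le_trans (Qp_ultrametric (iter N g y) _ _) _; rewrite ge_max lexx /=.
by rewrite metric_sym (le_trans (Hh _ _)).
Qed.

(** Exchanging [f] and [g] gives a second map, inverse to the first by expansivity; both are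
    1-Lipschitz, so [h] is an isometry. *)
Lemma expanding_conjugacy r f f' g g' C : 1 < r -> 0 < C ->
  cancel f' f -> cancel g' g ->
  scaling r f -> scaling r g -> (forall x, mdist (f x) (g x) <= C) ->
  exists2 h, Defs.isometry h & conjugate_by h f g.
Proof.
move=> r1 C0 f'K g'K fr gr fg.
have [h [Hh fhg lh]] := semiconjugacy r1 C0 f'K fr gr fg.
have gf x : mdist (g x) (f x) <= C by rewrite metric_sym.
have [k [Hk _ lk]] := semiconjugacy r1 C0 g'K gr fr gf.
have hK : cancel h k.
  move=> x; apply: (expanding_expansive (C := C) r1 gr) => n.
  apply: le_trans (Qp_ultrametric (iter n f (h x)) _ _) _.
  by rewrite ge_max Hk Hh.
have kK : cancel k h.
  move=> x; apply: (expanding_expansive (C := C) r1 fr) => n.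
  apply: le_trans (Qp_ultrametric (iter n g (k x)) _ _) _.
  by rewrite ge_max Hk Hh.
have ih : Defs.isometry h.
  move=> x y; apply/eqP; rewrite eq_le lh.
  by rewrite -{1}(hK x) -{1}(hK y) lk.
exists h => //; split=> //; exists k.
by apply: (@scaling_inverse_homeo _ _ 1) => // x y; rewrite mul1r ih.
Qed.

(** For [r < 1] the inverses are expanding and within [C / r] of each other, and a conjugacy of the
    inverses is also one of the maps. *)
Lemma scaling_conjugacy r f f' g g' C : 0 < r -> r != 1 -> 0 < C ->
  cancel f f' -> cancel f' f -> cancel g g' -> cancel g' g ->
  scaling r f -> scaling r g -> (forall x, mdist (f x) (g x) <= C) ->
  exists2 h, Defs.isometry h & conjugate_by h f g.
Proof.
move=> r0 + C0 fK f'K gK g'K fr gr fg.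
rewrite neq_lt => /orP[r1|r1]; last exact: expanding_conjugacy fr gr fg.
have f'r : scaling r^-1 f' by apply: scaling_cancel fr; rewrite ?gt_eqF.
have g'r : scaling r^-1 g' by apply: scaling_cancel gr; rewrite ?gt_eqF.
have [|||h ih [hh fh]] :=
  @expanding_conjugacy r^-1 f' f g' g (C / r) _ _ fK gK f'r g'r.
- by rewrite invf_gt1.
- by rewrite divr_gt0.
- move=> x; rewrite ler_pdivlMr // mulrC -fr f'K -{1}(g'K x) metric_sym.
  exact: fg.
exists h => //; split=> //; apply/funext => x /=.
have /= := congr1 (fun F => F (g x)) fh.
by rewrite gK => <-; rewrite f'K.
Qed.

End ScalingMaps.

(** * Affine maps and their perturbations *)

Section AffineMaps.
Context (R : realType) (p : nat) (p_pr : prime p).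
Local Notation Qp := (Qp R p_pr).
Implicit Types (a b c z : Qp) (psi : Qp -> Qp).

Lemma affineK a b : a != 0 -> cancel (affine a b) (affine a^-1 (- (a^-1 * b))).
Proof. by move=> a0 z; rewrite /affine mulrDr mulKf // addrK. Qed.

Lemma affineVK a b : a != 0 -> cancel (affine a^-1 (- (a^-1 * b))) (affine a b).
Proof. by move=> a0 z; rewrite /affine mulrDr mulrN !mulVKf // subrK. Qed.

Lemma affine_scaling a b : scaling (padic_norm a) (affine a b).
Proof.
move=> x y; rewrite !Qp_mdistE -padic_normM /affine opprD addrACA subrr addr0.
by rewrite mulrBr.
Qed.

(** For distinct points the increment of the affine part strictly dominates that of [psi], so it
    alone determines the norm of the sum. *)
Lemma perturbed_scaling a b psi (eps : R) : eps < padic_norm a ->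
  (forall x y, mdist (psi x) (psi y) <= eps * mdist x y) ->
  scaling (padic_norm a) (affine a b \+ psi).
Proof.
move=> ea psiL x y; have [->|xy] := eqVneq x y; first by rewrite !mdistxx mulr0.
rewrite -(affine_scaling a b) [LHS]Qp_mdistE [RHS]Qp_mdistE /=.
rewrite opprD addrACA -[psi x - _]opprB; apply: padic_norm_lt_eq.
rewrite -!Qp_mdistE affine_scaling metric_sym.
by apply: le_lt_trans (psiL x y) _; rewrite ltr_pM2r // mdist_gt0.
Qed.

(** Solving for the linear term turns the equation into a fixed point problem for a contraction of
    ratio [eps / padic_norm a]. *)
Lemma perturbed_surjective a b psi (eps : R) : 0 < eps < padic_norm a ->
  (forall x y, mdist (psi x) (psi y) <= eps * mdist x y) ->
  forall z, exists x, (affine a b \+ psi) x = z.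
Proof.
move=> /andP[e0 ea] psiL z; have na0 := lt_trans e0 ea.
have a0 : a != 0 by rewrite -padic_norm_gt0.
have [||x Hx] := @Qp_contraction_fixpoint R p p_pr (eps / padic_norm a)
  (fun x => a^-1 * (z - b - psi x)).
- by rewrite divr_gt0 // ltr_pdivrMr // mul1r.
- move=> x y; rewrite Qp_mdistE -mulrBr padic_normM padic_normV opprB addrC.
  rewrite addrA subrK -Qp_mdistE [eps / _]mulrC -mulrA.
  by rewrite ler_pM2l ?invr_gt0 // metric_sym.
exists x; rewrite /= /affine -[in a * x]Hx mulVKf //.
by rewrite [z - b - _ + _]addrAC !subrK.
Qed.

Lemma affine_isometric_stability a b : a != 0 -> padic_norm a != 1 ->
  isometrically_lipschitz_structurally_stable (affine a b).
Proof.
move=> a0 a1; have na0 : 0 < padic_norm a by rewrite padic_norm_gt0.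
pose eps := padic_norm a / 2.
have e0 : 0 < eps by rewrite divr_gt0.
have ea : eps < padic_norm a by rewrite ltr_pdivrMr // ltr_pMr // ltr1n.
exists eps => // psi [psiL psi_sup].
have gr := @perturbed_scaling a b psi _ ea psiL.
have [g' g'K] := choice (@perturbed_surjective a b psi eps
  (introT andP (conj e0 ea)) psiL).
have gK : cancel (affine a b \+ psi) g'.
  by move=> x; apply: (scaling_inj _ gr); rewrite ?gt_eqF.
apply: (scaling_conjugacy na0 a1 e0 (@affineK a b a0) (@affineVK a b a0)
  gK g'K (@affine_scaling a b) gr) => x.
(* The supremum bound on [psi] serves as the distance between the two maps. *)
rewrite metric_sym Qp_mdistE /= addrAC subrr add0r -lee_fin.
by apply: le_trans (ltW psi_sup); apply: ereal_sup_ubound; exists x.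
Qed.

(** On each sphere about 0 the map is multiplication by a single element of norm 1; two points of
    different norms lie at a distance equal to the larger norm, which is preserved. *)
Lemma norm_preserving_twist (u : Qp -> Qp) :
  (forall z, padic_norm (u z) = 1) ->
  (forall z w, padic_norm z = padic_norm w -> u z = u w) ->
  Defs.isometry (fun z => u z * z) /\
  cancel (fun z => u z * z) (fun z => (u z)^-1 * z).
Proof.
move=> u1 uE; have nu z : padic_norm (u z * z) = padic_norm z.
  by rewrite padic_normM u1 mul1r.
split=> [z w|z]; last first.
  rewrite (uE _ z (nu z)) mulKf //.
  by rewrite -padic_norm_eq0E u1 oner_neq0.
have [zw|zw] := eqVneq (padic_norm z) (padic_norm w).
  by rewrite !Qp_mdistE (uE _ _ zw) -mulrBr padic_normM u1 mul1r.
wlog lt_zw : z w {zw} / padic_norm z < padic_norm w => [H|].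
  move: zw; rewrite neq_lt => /orP[]/H//.
  by rewrite metric_sym [RHS]metric_sym.
rewrite metric_sym [RHS]metric_sym !Qp_mdistE.
by rewrite !padic_norm_lt_eq // !nu.
Qed.

Lemma padic_norm_p : padic_norm (p%:R : Qp) = p%:R^-1.
Proof.
have -> : (p%:R : Qp) = ratr p%:R by rewrite ratr_nat.
rewrite padic_norm_ratr /padic_abs pnatr_eq0 eqn0Ngt prime_gt0 //=.
have := @padic_val_frac p p 1; rewrite divr1 logn1 subr0 logn_prime // eqxx.
by move=> ->; rewrite ?exprN1 // eqz_nat -lt0n prime_gt0.
Qed.

Lemma affine_linear_conjugate a b (k : int) : padic_norm a = p%:R ^ k ->
  k != 0 -> topologically_conjugate (affine a b) (affine (1 / p%:R ^ k) 0).
Proof.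
move=> ak k0.
have p1 : 1 < p%:R :> R by rewrite ltr1n prime_gt1.
have p0 : 0 < p%:R :> R by apply: lt_trans p1.
have p_inj : injective (exprz (p%:R : R)) by apply: ieexprIz; rewrite ?gt_eqF.
have pz : p%:R != 0 :> Qp by rewrite -padic_norm_gt0 padic_norm_p invr_gt0.
have pkz : p%:R ^ k != 0 :> Qp by rewrite expfz_neq0.
have a1 : 1 - a != 0.
  rewrite subr_eq0; apply: contra_neq k0 => a1.
  by apply: p_inj; rewrite -ak -a1 expr0z padic_norm1.
(* The fixed point of [affine a b], available because [k != 0] forces [a] to differ from 1. *)
pose s := b / (1 - a).
have as_s : a * s + b = s.
  rewrite -[b in LHS](divfK a1) -/s mulrBr mulr1 [s * a]mulrC.
  by rewrite addrCA subrr addr0.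
have norm_exp z : exists m : int, z != 0 -> padic_norm z = p%:R ^ m.
  have [->|/padic_norm_pow[n Hn]] := eqVneq z 0; first by exists 0.
  by exists n.
have [m Hm] := choice norm_exp.
pose v := a * p%:R ^ k.
have nv : padic_norm v = 1.
  rewrite padic_normM padic_normXz padic_norm_p ak -expfzMl.
  by rewrite divff ?gt_eqF // exp1rz.
have vz : v != 0 by rewrite -padic_norm_eq0E nv oner_neq0.
(* With sign, [q z] counts the multiplications by [p ^ (- k)] leading to [z] from the sphere of
   exponent [m z %% k]. The exponent chosen at 0 is arbitrary, hence the separate value. *)
pose q z := if z == 0 then 0 else (m z %/ k)%Z.
pose u z := v ^ q z.
have nu z : padic_norm (u z) = 1 by rewrite padic_normXz nv exp1rz.
have uE z w : padic_norm z = padic_norm w -> u z = u w.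
  move=> zw; rewrite /u /q -(padic_norm_eq0E z) zw padic_norm_eq0E.
  have [//|w0] := eqVneq w 0.
  suff -> : m z = m w by [].
  apply: p_inj; rewrite -!Hm //.
  by rewrite -padic_norm_eq0E zw padic_norm_eq0E.
have [uI uK] := norm_preserving_twist nu uE.
have nuV z : padic_norm (u z)^-1 = 1 by rewrite padic_normV nu invr1.
have uVE z w : padic_norm z = padic_norm w -> (u z)^-1 = (u w)^-1.
  by move=> /uE ->.
have [_ uVK] := norm_preserving_twist nuV uVE.
exists (fun z => u z * z + s); split.
  exists (fun z => (u (z - s))^-1 * (z - s)).
  apply: (@scaling_inverse_homeo _ _ 1) => // [z|z|z w].
  - by rewrite addrK uK.
  - by have := uVK (z - s); rewrite invrK => ->; rewrite subrK.
  - by rewrite mul1r -[RHS]uI !Qp_mdistE opprD addrACA subrr addr0.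
apply/funext => z /=; rewrite /affine addr0 mul1r mulrDr -addrA as_s.
congr (_ + s).
have [->|z0] := eqVneq z 0; first by rewrite !mulr0.
have w0 : (p%:R ^ k)^-1 * z != 0 by rewrite mulf_neq0 // invr_eq0.
(* Dividing by [p ^ k] adds [k] to the exponent, hence 1 to [q]; the extra factor [v] then turns
   [p ^ (- k)] into [a]. *)
have mw : m ((p%:R ^ k)^-1 * z) = k + m z.
  apply: p_inj; rewrite -Hm // padic_normM padic_normV padic_normXz padic_norm_p.
  by rewrite Hm // expfzDr ?gt_eqF // invr_expz exprz_inv opprK.
rewrite /u /q (negPf w0) (negPf z0) mw -[k in (k + _)%Z]mul1r divzMDl //.
rewrite expfzDr // expr1z /v.
set w := (_ ^ (m z %/ k)%Z).
by rewrite mulrAC -!mulrA mulVKf // [z * w]mulrC.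
Qed.
End AffineMaps.

Theorem theorem26 (R : realType) (p : nat) (p_pr : prime p)
    (a b : Qp R p_pr) (a_neq0 : a != 0) :
  shadowing (affine a b) /\
  (padic_norm a <> 1 ->
    [/\ lipschitz_structurally_stable (affine a b),
        isometrically_lipschitz_structurally_stable (affine a b) &
        exists k : int, [/\ k != 0, padic_norm a = p%:R ^ k &
          topologically_conjugate (affine a b) (affine (1 / p%:R ^ k) 0)]]).
Proof.
have na0 : 0 < padic_norm a by rewrite padic_norm_gt0.
split.
  exact: (scaling_shadowing na0 (affineK b a_neq0) (affineVK b a_neq0)
    (affine_scaling a b)).
move=> /eqP a1; have stable := affine_isometric_stability b a_neq0 a1.
split=> //.
  split; first exact: scaling_continuous na0 (affine_scaling a b).
  have [e e0 He] := stable; exists e => // psi /He[h _ hc].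
  by exists h.
have [k ak] := padic_norm_pow a_neq0.
have k0 : k != 0 by apply: contra_neq a1 => k0; rewrite ak k0 expr0z.
by exists k; split=> //; exact: affine_linear_conjugate.
Qed.
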